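(* Let $N\ge 2$ and let $F(q,m)=[F_1(q,m),\dots,F_N(q,m)]^T\in\mathbb{R}^{2N}$ be given by $$F_i(q,m)=\sum_{j=1,\,j\ne i}^{N}\frac{m_im_j(q_j-q_i)}{\|q_j-q_i\|^3}+\frac{U(q)}{I(q)}\,m_iq_i,\qquad i=1,\dots,N,$$ where $U(q)=\sum_{1\le i<j\le N}\frac{m_im_j}{\|q_i-q_j\|}$ and $I(q)=\sum_{i=1}^N m_i\|q_i\|^2$. Let $q_0$ be a central configuration for the mass vector $m_0$ in the sense that $F(q_0,m_0)=0$. Let $$P=\begin{bmatrix} B_1 & 0\\ B_2 & \mathrm{Id}\end{bmatrix}\in\mathbb{R}^{2N\times 2N},\qquad \begin{bmatrix} B_1\\ B_2\end{bmatrix}=[\,A'(0)q_0,\ q_0\,],$$ where the right-hand side is the $2N\times 2$ matrix with columns $A'(0)q_0$ and $q_0$, $B_1$ is $2\times 2$, $B_2$ is $(2N-2)\times 2$, $\mathrm{Id}$ is the $(2N-2)\times(2N-2)$ identity matrix, and suppose that $P$ is invertible. Then $$P^{-1}\,\mathrm{Jac}(F)|_{(q_0,m_0)}\,P=\begin{bmatrix} 0 & J_1\\ 0 & J_2\end{bmatrix}$$ with $J_2$ a $(2N-2)\times(2N-2)$ matrix.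
   Context: Masses $m=(m_1,\dots,m_N)$ are positive. Positions are $q=(q_1,\dots,q_N)\in\mathbb{R}^{2N}$ with $q_i=(x_i,y_i)^T\in\mathbb{R}^2$, written as a column $(x_1,y_1,\dots,x_N,y_N)^T$, and configurations are collision-free ($q_i\neq q_j$ for $i\ne j$). $\|\cdot\|$ is the Euclidean norm. $\mathrm{Jac}(F)|_{(q_0,m_0)}$ is the $2N\times 2N$ Jacobian matrix of $F$ with respect to $q$ (with $U$ and $I$ regarded as functions of $q$), evaluated at $(q_0,m_0)$. Let $A(t)=\begin{bmatrix}\cos t&-\sin t\\ \sin t&\cos t\end{bmatrix}$ act diagonally on $\mathbb{R}^{2N}$ by $A(t)q=(A(t)q_1,\dots,A(t)q_N)$; thus, for $q_0=(x_{10},y_{10},\dots,x_{N0},y_{N0})^T$, $A'(0)q_0=(-y_{10},x_{10},\dots,-y_{N0},x_{N0})^T$. *)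

(* Defs.v *)
From HB Require Import structures.
From mathcomp Require Import all_boot all_order all_algebra.
From mathcomp Require Import all_classical all_reals all_analysis.

Set Implicit Arguments.
Unset Strict Implicit.
Unset Printing Implicit Defensive.

Import Order.TTheory GRing.Theory Num.Theory.
Import numFieldNormedType.Exports.

Local Open Scope ring_scope.

Section Coordinates.
Variables (R : realType) (N : nat).

Fact coord_subproof (i : 'I_N) (c : 'I_2) : (2 * i + c < 2 * N)%N.
Proof.
apply: (@leq_trans (2 * i.+1)); last by rewrite leq_pmul2l.
by rewrite mulnS addnC ltn_add2r.
Qed.

(* The place of coordinate c of q_i (c = 0 for x_i, c = 1 for y_i) in the
   column (x_1, y_1, ..., x_N, y_N)^T, everything being counted from 0. *)
Definition coord_index (i : 'I_N) (c : 'I_2) : 'I_(2 * N) :=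
  Ordinal (coord_subproof i c).

Fact body_of_subproof (k : 'I_(2 * N)) : (k %/ 2 < N)%N.
Proof. by rewrite ltn_divLR // [X in (_ < X)%N]mulnC. Qed.

Fact axis_of_subproof (k : 'I_(2 * N)) : (k %% 2 < 2)%N.
Proof. by rewrite ltn_mod. Qed.

Definition position (q : 'cV[R]_(2 * N)) (i : 'I_N) : 'cV[R]_2 :=
  \col_c q (coord_index i c) 0.

Definition stack (f : 'I_N -> 'cV[R]_2) : 'cV[R]_(2 * N) :=
  \col_k f (Ordinal (body_of_subproof k)) (Ordinal (axis_of_subproof k)) 0.

Lemma stackK (f : 'I_N -> 'cV[R]_2) : position (stack f) = f.
Proof.
apply/funext => i; apply/matrixP => c j; rewrite !mxE ord1.
congr (f _ _ _); apply/val_inj => /=.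
  by rewrite mulnC divnMDl // divn_small // addn0.
by rewrite mulnC modnMDl modn_small.
Qed.

Lemma positionK (q : 'cV[R]_(2 * N)) : stack (position q) = q.
Proof.
apply/matrixP => k j; rewrite !mxE ord1; congr (q _ _); apply/val_inj => /=.
by rewrite mulnC -divn_eq.
Qed.

End Coordinates.

(* The library's norm on matrices is the maximum norm. *)
Definition enorm (R : realType) (n : nat) (v : 'cV[R]_n) : R :=
  Num.sqrt (\sum_k v k 0 ^+ 2).

Definition collision_free (R : realType) (N : nat) (q : 'cV[R]_(2 * N)) : Prop :=
  forall i j : 'I_N, i != j -> position q i != position q j.

Definition potential (R : realType) (N : nat) (q : 'cV[R]_(2 * N))
    (m : 'I_N -> R) : R :=
  \sum_(i < N) \sum_(j < N | (i < j)%N)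
    m i * m j / enorm (position q i - position q j).

Definition inertia (R : realType) (N : nat) (q : 'cV[R]_(2 * N))
    (m : 'I_N -> R) : R :=
  \sum_(i < N) m i * enorm (position q i) ^+ 2.

Definition ccF (R : realType) (N : nat) (q : 'cV[R]_(2 * N))
    (m : 'I_N -> R) : 'cV[R]_(2 * N) :=
  stack (fun i =>
    \sum_(j < N | j != i)
      (m i * m j / enorm (position q j - position q i) ^+ 3)
        *: (position q j - position q i)
    + (potential q m / inertia q m * m i) *: position q i).

(* Entry (i, j) is the partial derivative of the i-th component in the j-th
   variable; the library's jacobian is the transposed matrix, for row vectors. *)
Definition Jac (R : realType) (n p : nat) (f : 'cV[R]_n -> 'cV[R]_p)
    (a : 'cV[R]_n) : 'M[R]_(p, n) :=
  \matrix_(i < p, j < n) 'D_(delta_mx j 0) (fun x => f x i 0) a.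

Definition rotation (R : realType) (t : R) : 'M[R]_2 :=
  \matrix_(a < 2, b < 2)
    nth 0 (nth [::] [:: [:: cos t; - sin t]; [:: sin t; cos t]] a) b.

Definition diag_act (R : realType) (N : nat) (B : 'M[R]_2)
    (q : 'cV[R]_(2 * N)) : 'cV[R]_(2 * N) :=
  stack (fun i => B *m position q i).

Lemma block_dim (N : nat) (hN : (1 < N)%N) : (2 + (2 * N - 2) = 2 * N)%N.
Proof. by rewrite subnKC // -[X in (X <= _)%N]muln1 leq_pmul2l // ltnW. Qed.

(* Main.v *)
Require Import Defs.
From HB Require Import structures.
From mathcomp Require Import all_boot all_order all_algebra.
From mathcomp Require Import all_classical all_reals all_analysis.
From mathcomp Require Import ring.

Set Implicit Arguments.
Unset Strict Implicit.
Unset Printing Implicit Defensive.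

Import Order.TTheory GRing.Theory Num.Theory.
Import numFieldNormedType.Exports.

Local Open Scope ring_scope.

(** The map F is equivariant under similarities: if C is a linear map of the
    plane with |Cv| = s|v|, then F(Cq) = s^-3 C F(q), because U(Cq) = U(q)/s and
    I(Cq) = s^2 I(q).  For D = A'(0) and for D = Id, the matrix Id + tD is such
    a similarity, so F vanishes on the whole line q0 + t D q0.  As F is
    differentiable at the collision-free point q0, Jac(F) kills both A'(0)q0
    and q0, which are the first two columns of P. *)

(** * The Euclidean norm *)

Section Enorm.
Variables (R : realType) (n : nat).
Implicit Type v : 'cV[R]_n.

Lemma enorm_sqr v : enorm v ^+ 2 = \sum_k v k 0 ^+ 2.
Proof. by rewrite sqr_sqrtr // sumr_ge0 // => k _; exact: sqr_ge0. Qed.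

Lemma enorm_eq0 v : (enorm v == 0) = (v == 0).
Proof.
apply/eqP/eqP => [/eqP|->]; last first.
  by rewrite /enorm big1 ?sqrtr0 // => k _; rewrite mxE expr0n.
rewrite -sqrf_eq0 enorm_sqr => /eqP sum0; apply/colP => k; rewrite mxE.
apply/eqP; rewrite -sqrf_eq0; apply/eqP.
by apply: (psumr_eq0P _ sum0) => // i _; exact: sqr_ge0.
Qed.

Lemma enorm_gt0 v : v != 0 -> 0 < enorm v.
Proof. by move=> v0; rewrite lt_def enorm_eq0 v0 sqrtr_ge0. Qed.

End Enorm.

(** * Differentiability of finite sums and of the norm *)

Section Differentiability.
Variables (R : realType) (V : normedModType R).

Lemma differentiable_sumP (I : Type) (r : seq I) (p : pred I)
    (f : I -> V -> R) (x : V) :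
  (forall i, p i -> differentiable (f i) x) ->
  differentiable (fun y => \sum_(i <- r | p i) f i y) x.
Proof.
move=> df; elim: r => [|i r IHr].
  under eq_fun do rewrite big_nil.
  exact: differentiable_cst.
under eq_fun do rewrite big_cons.
by case pi: (p i) => //; apply: differentiableD => //; exact: df.
Qed.

(** Away from zero the sum of squares is positive, and there the square root is differentiable. *)
Lemma differentiable_enorm n (f : V -> 'cV[R]_n) (x : V) :
  (forall k, differentiable (fun y => f y k 0) x) -> f x != 0 ->
  differentiable (fun y => enorm (f y)) x.
Proof.
move=> df fx0.
pose S (y : V) := \sum_k f y k 0 ^+ 2.
have dS : differentiable S x.
  (* [differentiableX] concerns the exponent [n.+1], so the argument 1 yields a square. *)
  by apply: differentiable_sumP => k _; exact: (@differentiableX _ _ _ 1).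
apply: (differentiable_comp (f := S) (g := Num.sqrt)) => //.
apply/derivable1_diffP; apply: ex_derive; apply: is_derive1_sqrt.
by rewrite -sqrtr_gt0; exact: enorm_gt0.
Qed.

End Differentiability.

(** * Smoothness and equivariance of F *)

Section ForceMap.
Variables (R : realType) (N : nat) (m : 'I_N -> R).
Implicit Type q : 'cV[R]_(2 * N).

Lemma differentiable_position q i c :
  differentiable (fun x : 'cV[R]_(2 * N) => position x i c 0) q.
Proof.
rewrite (_ : (fun _ => _) = fun x : 'cV[R]_(2 * N) => x (coord_index i c) 0).
  exact: differentiable_coord.
by apply/funext => x; rewrite mxE.
Qed.

Lemma differentiable_positionB q i j c :
  differentiable
    (fun x : 'cV[R]_(2 * N) => (position x i - position x j) c 0) q.
Proof.
under eq_fun do rewrite mxE [X in _ + X]mxE.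
by apply: differentiableB; exact: differentiable_position.
Qed.

Lemma differentiable_enorm_positionB q i j :
  collision_free q -> i != j ->
  differentiable
    (fun x : 'cV[R]_(2 * N) => enorm (position x i - position x j)) q.
Proof.
move=> qfree ij; apply: differentiable_enorm.
  by move=> c; exact: differentiable_positionB.
by rewrite subr_eq0 qfree.
Qed.

Lemma enorm_positionB_neq0 q i j :
  collision_free q -> i != j -> enorm (position q i - position q j) != 0.
Proof. by move=> qfree ij; rewrite enorm_eq0 subr_eq0 qfree. Qed.

Lemma differentiable_potential q :
  collision_free q -> differentiable (fun x => potential x m) q.
Proof.
move=> qfree; apply: differentiable_sumP => i _.
apply: differentiable_sumP => j ij.
have {}ij : i != j by rewrite neq_ltn ij.
apply: differentiableM; first exact: differentiable_cst.
apply: differentiableV; first exact: differentiable_enorm_positionB.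
exact: enorm_positionB_neq0.
Qed.

(** The norm enters only through its square, which is polynomial, so a body at the origin does no
    harm. *)
Lemma differentiable_inertia q : differentiable (fun x => inertia x m) q.
Proof.
apply: differentiable_sumP => i _.
apply: differentiableM; first exact: differentiable_cst.
under eq_fun do rewrite enorm_sqr.
apply: differentiable_sumP => c _; apply: (@differentiableX _ _ _ 1).
exact: differentiable_position.
Qed.

(** If I vanished, every body would sit at the origin, and bodies 0 and 1 would collide. *)
Lemma inertia_gt0 q : (2 <= N)%N -> (forall i, 0 < m i) ->
  collision_free q -> 0 < inertia q m.
Proof.
move=> hN m_gt0 qfree.
have term_ge0 i : 0 <= m i * enorm (position q i) ^+ 2.
  by rewrite mulr_ge0 ?sqr_ge0 // ltW.
rewrite lt_def sumr_ge0 ?andbT => [|i _ //].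
apply/eqP => /psumr_eq0P inertia0.
have position0 i : position q i = 0.
  have /eqP := inertia0 (fun i _ => term_ge0 i) i isT.
  by rewrite mulf_eq0 gt_eqF //= sqrf_eq0 enorm_eq0 => /eqP.
have := qfree (Ordinal (ltnW hN)) (Ordinal hN) isT.
by rewrite !position0 eqxx.
Qed.

Lemma differentiable_ccF q k : (2 <= N)%N -> (forall i, 0 < m i) ->
  collision_free q -> differentiable (fun x => ccF x m k 0) q.
Proof.
move=> hN m_gt0 qfree; set i := Ordinal (body_of_subproof k).
set c := Ordinal (axis_of_subproof k).
(* Written as a scalar expression, the component is open to the rules for real-valued maps. *)
rewrite (_ : (fun _ => _) = fun x =>
  \sum_(j < N | j != i)
      (m i * m j / enorm (position x j - position x i) ^+ 3)
        * (position x j - position x i) c 0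
  + (potential x m / inertia x m * m i) * position x i c 0); last first.
  apply/funext => x; rewrite mxE mxE summxE; congr (_ + _).
    by apply: eq_bigr => j _; rewrite mxE.
  by rewrite mxE.
apply: differentiableD.
  apply: differentiable_sumP => j ji.
  apply: differentiableM; last exact: differentiable_positionB.
  apply: differentiableM; first exact: differentiable_cst.
  apply: differentiableV; last by rewrite expf_neq0 // enorm_positionB_neq0.
  apply: (@differentiableX _ _ _ 2).
  exact: differentiable_enorm_positionB.
apply: differentiableM; last exact: differentiable_position.
apply: differentiableM; last exact: differentiable_cst.
apply: differentiableM; first exact: differentiable_potential.
apply: differentiableV; first exact: differentiable_inertia.
by rewrite gt_eqF // inertia_gt0.
Qed.

Lemma positionD q q' i : position (q + q') i = position q i + position q' i.
Proof. by apply/colP => c; rewrite !mxE. Qed.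

Lemma positionZ a q i : position (a *: q) i = a *: position q i.
Proof. by apply/colP => c; rewrite !mxE. Qed.

Lemma position_diag_act (C : 'M[R]_2) q i :
  position (diag_act C q) i = C *m position q i.
Proof. by rewrite /diag_act stackK. Qed.

(* For [s = 0] both sides are [0], by the convention [0^-1 = 0]. *)
Lemma ccF_similarity (C : 'M[R]_2) (s : R) q :
  (forall v : 'cV_2, enorm (C *m v) = s * enorm v) ->
  ccF (diag_act C q) m = s ^- 3 *: diag_act C (ccF q m).
Proof.
move=> normC.
have U_C : potential (diag_act C q) m = s^-1 * potential q m.
  rewrite /potential mulr_sumr; apply: eq_bigr => i _.
  rewrite mulr_sumr; apply: eq_bigr => j _.
  by rewrite stackK -mulmxBr normC invfM mulrCA.
have I_C : inertia (diag_act C q) m = s ^+ 2 * inertia q m.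
  rewrite /inertia mulr_sumr; apply: eq_bigr => i _.
  by rewrite stackK normC exprMn mulrCA.
rewrite -[LHS]positionK -[RHS]positionK; congr stack; apply/funext => i.
rewrite positionZ position_diag_act !stackK mulmxDr mulmx_sumr.
rewrite scalerDr scaler_sumr; congr (_ + _).
  apply: eq_bigr => j _.
  by rewrite -mulmxBr normC -scalemxAr scalerA exprMn invfM mulrCA.
rewrite -scalemxAr scalerA U_C I_C; congr (_ *: _).
(* The factor [s ^- 3] splits into [s^-1] from U and [(s ^+ 2)^-1] from 1/I. *)
rewrite exprS [(s * _)^-1]invfM [(s ^+ 2 * _)^-1]invfM -!mulrA.
by congr (_ * _); exact: mulrCA.
Qed.

End ForceMap.

(** * Similarities of the plane and A'(0) *)

Section Similarities.
Variable R : realType.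

Definition quarter_turn : 'M[R]_2 := delta_mx 1 0 - delta_mx 0 1.

(** Multiplication by the complex number a + ib. The pair (0, 1) gives A'(0) and (1, 0) the
    identity. *)
Definition similarity (a b : R) : 'M[R]_2 := a%:M + b *: quarter_turn.

(** This is |zw| = |z||w| for complex numbers: the cross terms cancel in the sum of the two
    squares. *)
Lemma enorm_similarity a b (v : 'cV[R]_2) :
  enorm (similarity a b *m v) = Num.sqrt (a ^+ 2 + b ^+ 2) * enorm v.
Proof.
rewrite /enorm -sqrtrM ?addr_ge0 ?sqr_ge0 //; congr Num.sqrt.
rewrite !big_ord_recl !big_ord0 !mxE !big_ord_recl !big_ord0 !mxE /=.
rewrite !(mulr1n, mulr0n, addr0, add0r, subr0, sub0r, mulr0, mulr1, mulrN1).
by ring.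
Qed.

Lemma similarity_line a b t :
  1%:M + t *: similarity a b = similarity (1 + t * a) (t * b).
Proof.
by rewrite /similarity scalerDr scalerA scale_scalar_mx addrA -raddfD.
Qed.

Lemma derive1_rotation0 : derive1 (@rotation R) 0 = similarity 0 1.
Proof.
have D i j : is_derive (0 : R) 1 (fun t => rotation t i j) (similarity 0 1 i j).
  case: i j => -[|[|//]] i2 [[|[|//]] j2].
  - rewrite (_ : (fun _ => _) = @cos R); last by apply/funext => t; rewrite mxE.
    by apply: is_derive_eq; rewrite !mxE /= sin0; ring.
  - rewrite (_ : (fun _ => _) = - @sin R); last by apply/funext => t; rewrite mxE.
    by apply: is_derive_eq; rewrite !mxE /= cos0; ring.
  - rewrite (_ : (fun _ => _) = @sin R); last by apply/funext => t; rewrite mxE.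
    by apply: is_derive_eq; rewrite !mxE /= cos0; ring.
  - rewrite (_ : (fun _ => _) = @cos R); last by apply/funext => t; rewrite mxE.
    by apply: is_derive_eq; rewrite !mxE /= sin0; ring.
have derivable_rotation : derivable (@rotation R) 0 1.
  by apply/derivable_mxP => i j; exact: ex_derive.
rewrite derive1E derive_mx //; apply/matrixP => i j.
by rewrite mxE; exact: derive_val.
Qed.

End Similarities.

(** * Kernel vectors of the Jacobian *)

Section Jacobian.
Variable R : realType.

(** [Jac] records partial derivatives only; differentiability makes the directional derivative
    linear in [v], so it is determined by them. *)
Lemma mul_Jac n p (f : 'cV[R]_n -> 'cV[R]_p) (a v : 'cV[R]_n) :
  (forall k, differentiable (fun x => f x k 0) a) ->
  Jac f a *m v = \col_k 'D_v (fun x => f x k 0) a.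
Proof.
move=> df; apply/colP => k; rewrite !mxE deriveE //.
rewrite [in RHS](matrix_sum_delta v) linear_sum; apply: eq_bigr => j _.
by rewrite big_ord1 linearZ mxE deriveE // mulrC.
Qed.

(** Along a line of zeros, every difference quotient in the direction [v] is zero. *)
Lemma mul_Jac_eq0 n p (f : 'cV[R]_n -> 'cV[R]_p) (a v : 'cV[R]_n) :
  (forall k, differentiable (fun x => f x k 0) a) ->
  (forall t, f (a + t *: v) = 0) -> Jac f a *m v = 0.
Proof.
move=> df f0; rewrite mul_Jac //; apply/colP => k; rewrite !mxE.
have fa0 : f a = 0 by rewrite -(f0 0) scale0r addr0.
rewrite /derive; apply/cvg_lim => //.
rewrite (_ : (fun _ => _) = cst 0); first exact: cvg_cst.
by apply/funext => t; rewrite /= [_ + a]addrC f0 fa0 !mxE subr0 scaler0.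
Qed.

Lemma mul_Jac_ccF_similarity N (m : 'I_N -> R) (q : 'cV[R]_(2 * N)) (a b : R) :
  (2 <= N)%N -> (forall i, 0 < m i) -> collision_free q -> ccF q m = 0 ->
  Jac (fun x => ccF x m) q *m diag_act (similarity a b) q = 0.
Proof.
move=> hN m_gt0 qfree q_cc; apply: mul_Jac_eq0.
  by move=> k; exact: differentiable_ccF.
move=> t.
have -> : q + t *: diag_act (similarity a b) q =
          diag_act (similarity (1 + t * a) (t * b)) q.
  rewrite -similarity_line -[LHS]positionK; congr stack; apply/funext => i.
  by rewrite positionD positionZ position_diag_act mulmxDl mul1mx -scalemxAl.
(* The similarity may degenerate to 0 (a = 1, b = 0, t = -1); the right-hand side still vanishes,
   since F(q) = 0. *)
rewrite (ccF_similarity _ _ (@enorm_similarity _ _ _)) q_cc.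
by apply/colP => k; rewrite !mxE big1 ?mulr0 // => c _; rewrite !mxE mulr0.
Qed.

End Jacobian.

(** The first block column of the product is [Q] applied to [A] times the stacked [B1], [B2], hence
    0; the second is cut into [J1] and [J2]. *)
Lemma conj_block_kernel (K : fieldType) (p k n : nat) (e : (p + k = n)%N)
    (A Q : 'M[K]_n) (B1 : 'M[K]_p) (B2 : 'M[K]_(k, p)) :
  A *m castmx (e, erefl) (col_mx B1 B2) = 0 ->
  exists (J1 : 'M[K]_(p, k)) (J2 : 'M[K]_k),
    Q *m A *m castmx (e, e) (block_mx B1 0 B2 1%:M)
    = castmx (e, e) (block_mx 0 J1 0 J2).
Proof.
(* With [n] a variable, eliminating [e] turns every cast into the identity. *)
case: n / e A Q => A Q; rewrite !castmx_id => AB0.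
pose J := Q *m A *m col_mx 0 1%:M; exists (usubmx J), (dsubmx J).
rewrite castmx_id !block_mxEh mul_mx_row vsubmxK -mulmxA AB0 mulmx0.
by rewrite col_mx0.
Qed.

Theorem proposition3p5 (R : realType) (N : nat) (hN : (2 <= N)%N)
  (m0 : 'I_N -> R) (m0_gt0 : forall i, 0 < m0 i)
  (q0 : 'cV[R]_(2 * N)) (q0_free : collision_free q0)
  (q0_cc : ccF q0 m0 = 0)
  (B1 : 'M[R]_2) (B2 : 'M[R]_(2 * N - 2, 2))
  (hB : castmx (block_dim hN, erefl) (col_mx B1 B2)
        = row_mx (diag_act (derive1 (@rotation R) 0) q0) q0)
  (P : 'M[R]_(2 * N))
  (hP : P = castmx (block_dim hN, block_dim hN) (block_mx B1 0 B2 1%:M))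
  (P_unit : P \in unitmx) :
  exists (J1 : 'M[R]_(2, 2 * N - 2)) (J2 : 'M[R]_(2 * N - 2)),
    invmx P *m Jac (fun q => ccF q m0) q0 *m P
    = castmx (block_dim hN, block_dim hN) (block_mx 0 J1 0 J2).
Proof.
rewrite [X in _ *m X]hP; apply: conj_block_kernel; rewrite hB.
(* Seen as the image of itself under the identity similarity, [q0] falls under the same lemma as
   A'(0)q0. *)
have q0_similar : q0 = diag_act (similarity 1 0) q0.
  rewrite -[LHS]positionK; congr stack; apply/funext => i.
  by rewrite /similarity scale0r addr0 mul1mx.
(* [row_mx u v] has [1 + 1] columns and the goal has 2; stated apart, the equation meets the goal up
   to conversion. *)
have mul_row (A : 'M[R]_(2 * N)) (u v : 'cV[R]_(2 * N)) :
    A *m u = 0 -> A *m v = 0 -> A *m row_mx u v = 0.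
  by move=> Au Av; rewrite mul_mx_row Au Av row_mx0.
apply: mul_row.
  by rewrite derive1_rotation0 mul_Jac_ccF_similarity.
by rewrite {2}q0_similar mul_Jac_ccF_similarity.
Qed.
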